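(* Let $S\subseteq\mathbb{N}^2$ be a good semigroup with multiplicity vector $\boldsymbol{e}=(e_1,e_2)$. Then $\operatorname{edim}(S)\le e_1+e_2$.
   Context: $\mathbb{N}=\{0,1,2,\dots\}$. A submonoid $S$ of $(\mathbb{N}^2,+)$ is a good semigroup if: (G1) $\boldsymbol{\alpha},\boldsymbol{\beta}\in S$ implies $\min(\boldsymbol{\alpha},\boldsymbol{\beta})=(\min\{\alpha_1,\beta_1\},\min\{\alpha_2,\beta_2\})\in S$; (G2) there is $\boldsymbol{\delta}\in\mathbb{N}^2$ with $\boldsymbol{\delta}+\mathbb{N}^2\subseteq S$; (G3) if $\boldsymbol{\alpha},\boldsymbol{\beta}\in S$, $\boldsymbol{\alpha}\ne\boldsymbol{\beta}$ and $\alpha_i=\beta_i$ for some $i$, then there is $\boldsymbol{\epsilon}\in S$ with $\epsilon_i>\alpha_i=\beta_i$ and $\epsilon_j\ge\min\{\alpha_j,\beta_j\}$ for $j\neq i$, with equality if $\alpha_j\ne\beta_j$. Good semigroups are always assumed local: if $\boldsymbol{\alpha}\in S$ has a zero coordinate, then $\boldsymbol{\alpha}=\boldsymbol{0}$. The multiplicity vector of $S$ is $\boldsymbol{e}=(e_1,e_2)=\min(S\setminus\{\boldsymbol{0}\})$ (minimum for the componentwise order). Let $\overline{\mathbb{N}}=\mathbb{N}\cup\{\infty\}$ with $a<\infty$ for $a\in\mathbb{N}$ and $x+\infty=\infty$ for all $x$. Put $S_1^\infty=\{(a,\infty): a\in\mathbb{N},\ \exists\,\tilde y\ \forall y\ge\tilde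 y,\ (a,y)\in S\}$, $S_2^\infty=\{(\infty,b): b\in\mathbb{N},\ \exists\,\tilde x\ \forall x\ge\tilde x,\ (x,b)\in S\}$, $S^\infty=S_1^\infty\cup S_2^\infty\cup\{(\infty,\infty)\}$, $\Gamma_S=S\cup S^\infty$. A good semigroup is identified with $\Gamma_S$, so ''$S$ contains $\eta$'' means $\eta\subseteq\Gamma_S$. $\boldsymbol{\alpha}\in\Gamma_S\setminus\{\boldsymbol{0}\}$ is irreducible if $\boldsymbol{\alpha}=\boldsymbol{\beta}+\boldsymbol{\gamma}$ with $\boldsymbol{\beta},\boldsymbol{\gamma}\in\Gamma_S$ implies $\boldsymbol{\alpha}=\boldsymbol{\beta}$ or $\boldsymbol{\alpha}=\boldsymbol{\gamma}$. $\boldsymbol{\alpha}\in\Gamma_S$ is absolute if $\boldsymbol{\alpha}\in S^\infty$, or $\boldsymbol{\alpha}\in S\cap\mathbb{N}^2$ and no $\boldsymbol{\beta}\in S\cap\mathbb{N}^2$ satisfies ($\beta_1=\alpha_1,\beta_2>\alpha_2$) or ($\beta_2=\alpha_2,\beta_1>\alpha_1$). $I_A(S)$ is the set of irreducible absolute elements of $\Gamma_S$. For $\eta\subseteq\overline{\mathbb{N}}^2$, $S_\eta$ is the family of good semigroups containing $\eta$ that are minimal for inclusion among good semigroups containing $\eta$. The embedding dimension of $S$ is $\operatorname{edim}(S)=\min\{|\eta|: \eta\subseteq I_A(S),\ S\in S_\eta\}$. *)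

(* Defs.v *)
From mathcomp Require Import all_boot all_algebra.
From mathcomp Require Import all_classical.

Set Implicit Arguments.
Unset Strict Implicit.
Unset Printing Implicit Defensive.

Local Open Scope classical_set_scope.

(* [None] is the point at infinity. *)
Notation nbar := (option nat).

(* On [nat * nat], [+%R] and [0%R] are the componentwise addition and (0, 0). *)

Definition min2 (a b : nat * nat) : nat * nat :=
  (minn a.1 b.1, minn a.2 b.2).

Definition submonoid (S : set (nat * nat)) : Prop :=
  S 0%R /\ forall a b, S a -> S b -> S (a + b)%R.

Definition G1 (S : set (nat * nat)) : Prop :=
  forall a b, S a -> S b -> S (min2 a b).

Definition G2 (S : set (nat * nat)) : Prop :=
  exists d : nat * nat, forall a : nat * nat, S (d + a)%R.

Definition G3 (S : set (nat * nat)) : Prop :=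
  forall a b, S a -> S b -> a <> b ->
    (a.1 = b.1 ->
      exists c, [/\ S c, a.1 < c.1, minn a.2 b.2 <= c.2
                  & a.2 <> b.2 -> c.2 = minn a.2 b.2]) /\
    (a.2 = b.2 ->
      exists c, [/\ S c, a.2 < c.2, minn a.1 b.1 <= c.1
                  & a.1 <> b.1 -> c.1 = minn a.1 b.1]).

Definition local_semigroup (S : set (nat * nat)) : Prop :=
  forall a, S a -> a.1 = 0 \/ a.2 = 0 -> a = 0%R.

(* Good semigroups are local by convention. *)
Definition good_semigroup (S : set (nat * nat)) : Prop :=
  [/\ submonoid S, G1 S, G2 S, G3 S & local_semigroup S].

Definition is_multiplicity_vector (S : set (nat * nat)) (e : nat * nat) : Prop :=
  [/\ S e, e <> 0%R
    & forall a, S a -> a <> 0%R -> e.1 <= a.1 /\ e.2 <= a.2].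

Definition addbar (x y : nbar) : nbar :=
  match x, y with
  | Some m, Some n => Some (m + n)
  | _, _ => None
  end.

Definition addbar2 (x y : nbar * nbar) : nbar * nbar :=
  (addbar x.1 y.1, addbar x.2 y.2).

Definition fin2 (a : nat * nat) : nbar * nbar := (Some a.1, Some a.2).

Definition Sinf1 (S : set (nat * nat)) : set (nbar * nbar) :=
  [set x | exists a, x = (Some a, None) /\
             exists y0, forall y, y0 <= y -> S (a, y)].

Definition Sinf2 (S : set (nat * nat)) : set (nbar * nbar) :=
  [set x | exists b, x = (None, Some b) /\
             exists x0, forall x', x0 <= x' -> S (x', b)].

Definition Sinf (S : set (nat * nat)) : set (nbar * nbar) :=
  Sinf1 S `|` Sinf2 S `|` [set (None, None)].

Definition Gamma (S : set (nat * nat)) : set (nbar * nbar) :=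
  fin2 @` S `|` Sinf S.

Definition irreducible_elt (S : set (nat * nat)) (x : nbar * nbar) : Prop :=
  [/\ Gamma S x, x <> fin2 0%R
    & forall y z, Gamma S y -> Gamma S z -> x = addbar2 y z -> x = y \/ x = z].

Definition absolute (S : set (nat * nat)) (x : nbar * nbar) : Prop :=
  Sinf S x \/
  exists a, [/\ S a, x = fin2 a
    & ~ exists b, S b /\
          (b.1 = a.1 /\ a.2 < b.2 \/ b.2 = a.2 /\ a.1 < b.1)].

Definition I_A (S : set (nat * nat)) : set (nbar * nbar) :=
  [set x | irreducible_elt S x /\ absolute S x].

Definition contains (S : set (nat * nat)) (eta : set (nbar * nbar)) : Prop :=
  eta `<=` Gamma S.

Definition minimal_good (eta : set (nbar * nbar)) : set (set (nat * nat)) :=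
  [set S | [/\ good_semigroup S, contains S eta
    & forall T, good_semigroup T -> contains T eta -> T `<=` S -> T = S]].

(* Only finite [eta] contribute; an infinite one cannot lower the minimum. *)
Definition edim_sizes (S : set (nat * nat)) : set nat :=
  [set n | exists eta : set (nbar * nbar),
     [/\ eta `<=` I_A S, minimal_good eta S & (eta #= `I_n)%card]].

(* [is_edim S n] means edim(S) = n. A relation rather than a function into
   [nat], so that no default value is given when no finite [eta] exists. *)
Definition is_edim (S : set (nat * nat)) (n : nat) : Prop :=
  edim_sizes S n /\ forall m, edim_sizes S m -> n <= m.

(* Main.v *)
Require Import Defs.
From mathcomp Require Import all_boot all_algebra.
From mathcomp Require Import all_classical.
From mathcomp Require Import zify.

(** Write [pi_1 S] for the first projection of [S] and [B S] for the set of
    [b] such that (oo, b) belongs to [Gamma S].  Let [eta] consist of one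
    absolute element above each atom of the numerical semigroup [pi_1 S] and of
    the irreducible elements (oo, b).  Atoms of [pi_1 S] are distinct modulo
    [e.1], and irreducible (oo, b) are distinct modulo [e.2], whence
    [e.1 + e.2] elements at most.  For good semigroups [T `<=` S], the distance
    between them may be computed along any monotone lattice path, in particular
    along the horizontal axis and then a far away vertical line, so [T = S] as
    soon as [pi_1 T = pi_1 S] and [B T = B S].  If [T] contains [eta], the first
    equality is immediate; the second follows by induction on [b], since
    comparing two paths with ends 0 and (N, b) shows that the second projections
    of [S] and [T] also agree below [b]. *)

Set Implicit Arguments.
Unset Strict Implicit.
Unset Printing Implicit Defensive.

Local Open Scope classical_set_scope.

Definition swap_set (S : set (nat * nat)) : set (nat * nat) :=
  [set a | S (a.2, a.1)].

Definition in_proj1 (S : set (nat * nat)) (a : nat) : Prop := exists y, S (a, y).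

Definition in_proj2 (S : set (nat * nat)) (b : nat) : Prop := exists x, S (x, b).

Definition atom1 (S : set (nat * nat)) (a : nat) : Prop :=
  [/\ in_proj1 S a, 0 < a &
    forall u v, in_proj1 S u -> in_proj1 S v -> a = u + v -> u = 0 \/ v = 0].

(** This is the condition for the unit step from (a, b) to (a + 1, b) to count in the distance along
    a lattice path; [beyond] plays the same role for the step from (a, b) to (a, b + 1). *)
Definition above (S : set (nat * nat)) (a b : nat) : Prop :=
  exists2 y, b <= y & S (a, y).

Definition beyond (S : set (nat * nat)) (a b : nat) : Prop :=
  exists2 x, a <= x & S (x, b).

(** * The axioms in coordinates, tails and irreducible elements *)

Section Good.

Variable S : set (nat * nat).
Hypothesis hS : good_semigroup S.

Lemma good_add a b c d : S (a, b) -> S (c, d) -> S (a + c, b + d).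
Proof. by case: hS => -[_ SD] _ _ _ _; exact: (SD (a, b) (c, d)). Qed.

Lemma good_min a b c d : S (a, b) -> S (c, d) -> S (minn a c, minn b d).
Proof. by case: hS => _ Smin _ _ _; exact: (Smin (a, b) (c, d)). Qed.

Lemma good_local1 b : S (0, b) -> b = 0.
Proof. by case: hS => _ _ _ _ loc /loc/(_ (or_introl erefl))/(congr1 snd). Qed.

Lemma good_local2 a : S (a, 0) -> a = 0.
Proof. by case: hS => _ _ _ _ loc /loc/(_ (or_intror erefl))/(congr1 fst). Qed.

Lemma good_exchange1 a b b' : S (a, b) -> S (a, b') -> b < b' ->
  exists2 x, a < x & S (x, b).
Proof.
case: hS => _ _ _ G _ Sb Sb' ltb.
have [|+ _] := G _ _ Sb Sb'; first by case; lia.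
case=> // -[x y] /= [Sxy ltx _ e]; exists x => //.
by have <- : y = b by lia.
Qed.

Lemma good_exchange2 a a' b : S (a, b) -> S (a', b) -> a < a' ->
  exists2 y, b < y & S (a, y).
Proof.
case: hS => _ _ _ G _ Sa Sa' lta.
have [|_] := G _ _ Sa Sa'; first by case; lia.
case=> // -[x y] /= [Sxy lty _ e]; exists y => //.
by have <- : x = a by lia.
Qed.

Lemma good_swap : good_semigroup (swap_set S).
Proof.
case: hS => -[S0 SD] Smin [d Sd] G loc; split.
- by split=> // a b; exact: (SD (a.2, a.1) (b.2, b.1)).
- by move=> a b; exact: (Smin (a.2, a.1) (b.2, b.1)).
- by exists (d.2, d.1) => a; have := Sd (a.2, a.1).
- move=> [a1 a2] [b1 b2] Sa Sb neq.
  have [|h1 h2] := G _ _ Sa Sb; first by case=> ? ?; apply: neq; congr pair.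
  by split=> [/h2|/h1] [[c1 c2]] ?; exists (c2, c1).
- move=> [a1 a2] Sa h; suff [-> ->] : (a2, a1) = 0%R by [].
  by apply: loc Sa _; case: h; [right|left].
Qed.

(** At heights past the bound of G2, exchange with far points of the same row pushes (a, y)
    arbitrarily high; minima with points past that bound then reach every height. The bound is
    uniform in [a]. *)
Lemma good_vertical_tail :
  exists d, forall a y, S (a, y) -> d <= y -> forall y', d <= y' -> S (a, y').
Proof.
case: (hS) => _ _ [[d1 d2] Sd] _ _; exists d2 => a y Say dy.
have Sbig u v : d1 <= u -> d2 <= v -> S (u, v).
  move=> du dv; have := Sd (u - d1, v - d2).
  by rewrite [X in S X](_ : _ = (u, v))//; congr pair; exact: subnKC.
have up n : exists2 y', y + n <= y' & S (a, y').
  elim: n => [|n [y' le Sy']]; first by exists y; rewrite ?addn0.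
  have [//|||z lz Sz] := @good_exchange2 a (maxn d1 a.+1) y'; [|lia|].
    by apply: Sbig; lia.
  by exists z => //; lia.
move=> y' dy'; have [z lz Sz] := up y'.
have := good_min Sz (Sbig (maxn d1 a) y' (leq_maxl _ _) dy').
rewrite (minn_idPl (leq_maxr _ _)) (minn_idPr _) //.
by apply: leq_trans lz; exact: leq_addl.
Qed.

Lemma GammaE x : Gamma S x <->
  match x with
  | (Some a, Some b) => S (a, b)
  | (Some a, None) => exists y0, forall y, y0 <= y -> S (a, y)
  | (None, Some b) => exists x0, forall x', x0 <= x' -> S (x', b)
  | (None, None) => True
  end.
Proof.
split=> [[[[a b] Sab <-]//|[[]|->//]]|].
- by case=> a [->].
- by case=> b [->].
case: x => [[a|] [b|]].
- by move=> Sab; left; exists (a, b).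
- by move=> ?; right; left; left; exists a.
- by move=> ?; right; left; right; exists b.
- by move=> _; right; right.
Qed.

Lemma Gamma_proj1 a y : Gamma S (Some a, y) -> in_proj1 S a.
Proof.
move/GammaE; case: y => [y Say|[y0 Sy]]; first by exists y.
by exists y0; exact: Sy.
Qed.

Lemma Gamma_proj2 b x : Gamma S (x, Some b) -> in_proj2 S b.
Proof.
move/GammaE; case: x => [x Sxb|[x0 Sx]]; first by exists x.
by exists x0; exact: Sx.
Qed.

Lemma Gamma_zero1 y : Gamma S (Some 0, y) -> y = Some 0.
Proof.
move/GammaE; case: y => [y /good_local1 ->//|[y0 Sy]].
by have /good_local1 := Sy y0.+1 (leqnSn _).
Qed.

Lemma Gamma_inf_gt0 b : Gamma S (None, Some b) -> 0 < b.
Proof.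
move/GammaE => [x0 Sx]; case: b Sx => // Sx.
by have /good_local2 := Sx x0.+1 (leqnSn _).
Qed.

Lemma absolute_above a : in_proj1 S a ->
  exists y, Gamma S (Some a, y) /\ absolute S (Some a, y).
Proof.
case=> y Say; have [tail|ntail] := pselect (Sinf1 S (Some a, None)).
  by exists None; split; [right; left; left|left; left; left].
have [d Sd] := good_vertical_tail.
have ltd z : `[< S (a, z) >] -> z <= d.
  move=> /asboolP Saz; rewrite leqNgt; apply/negP => ltz; apply: ntail.
  by exists a; split=> //; exists d; apply: Sd Saz (ltnW ltz).
have ex : exists z, `[< S (a, z) >] by exists y; apply/asboolP.
case: (ex_maxnP ex ltd) => m /asboolP Sm maxm.
have no z : m < z -> ~ S (a, z).
  by move=> ltz Saz; have := maxm z (asboolT Saz); lia.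
exists (Some m); split; first exact/GammaE.
right; exists (a, m); split=> // -[[u v]] /= [Suv [[ua]|[vm]]] lt.
  by subst u; exact: no Suv.
(* An element further right in the row of (a, m) would yield one above it. *)
by subst v; have [z /no] := good_exchange2 Sm Suv lt.
Qed.

Lemma atom1_irreducible a y :
  atom1 S a -> Gamma S (Some a, y) -> irreducible_elt S (Some a, y).
Proof.
case=> _ a0 atom Gx; split=> //; first by case=> a00; rewrite a00 in a0.
move=> [[u|] y1] [[v|] y2] Gy Gz //= [auv ->].
have add0 z : addbar (Some 0) z = z by case: z.
have addr0 z : addbar z (Some 0) = z by case: z => //= n; rewrite addn0.
have [u0|v0] := atom u v (Gamma_proj1 Gy) (Gamma_proj1 Gz) auv.
  right; subst u; rewrite (Gamma_zero1 Gy) add0.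
  by rewrite /addbar2/= auv.
by left; subst v; rewrite (Gamma_zero1 Gz) addr0 auv addn0.
Qed.

(** One summand is (oo, u), with [u] positive by locality. The other may have a finite first
    coordinate, so only its height [v] is kept; it is positive since (oo, u) differs from (oo,
    b). *)
Lemma reducible_inf b : Gamma S (None, Some b) ->
  ~ irreducible_elt S (None, Some b) ->
  exists u v, [/\ b = u + v, 0 < u, 0 < v, Gamma S (None, Some u) & in_proj2 S v].
Proof.
move=> Gb nirr; apply: contrapT => no; apply: nirr; split=> // y z.
wlog: y z / y.1 = None.
  move=> h; case: y => [[p|] y].
    case: z => [[q|] z] // Gy Gz e; apply/or_comm; apply: h => //.
    by rewrite e /addbar2/=; congr pair; case: y z {Gy Gz e} => [?|] [?|]//=;
      rewrite addnC.
  exact: h.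
case: y z => [p [u|]] [q [v|]] //= -> Gy Gz [e]; left.
congr (_, Some _); case: v => [|v] in e Gz *; first by rewrite addn0 in e.
case: no; exists u, v.+1; split=> //; first exact: Gamma_inf_gt0.
exact: Gamma_proj2 Gz.
Qed.

Lemma proj1_muln a u k : in_proj1 S a -> in_proj1 S u -> in_proj1 S (a + k * u).
Proof.
move=> Sa [v Su]; elim: k => [|k [w Sw]]; first by rewrite addn0.
exists (w + v); rewrite mulSnr addnA; exact: good_add.
Qed.

Lemma proj1_zero : in_proj1 S 0.
Proof. by case: hS => -[S0 _] *; exists 0. Qed.

(** Congruent atoms differ by a multiple of [u], which lies in the projection, so the larger one
    would split. *)
Lemma atom1_modn u a a' : in_proj1 S u -> 0 < u -> atom1 S a -> atom1 S a' ->
  a = a' %[mod u] -> a = a'.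
Proof.
move=> Su u0; wlog le : a a' / a <= a'.
  by move=> h Ha Ha' e; case: (leqP a a') => [/h->//|/ltnW/h->].
move=> [Sa a0 _] [_ _ atom] /eqP; rewrite eq_sym eqn_mod_dvd// => /dvdnP[k e].
have e' : a' = a + k * u by lia.
have Sku : in_proj1 S (k * u).
  by rewrite -[_ * _]add0n; apply: proj1_muln => //; exact: proj1_zero.
by have [|] := atom _ _ Sa Sku e'; lia.
Qed.

End Good.

Lemma good_horizontal_tail S : good_semigroup S ->
  exists d, forall x b, S (x, b) -> d <= x -> forall x', d <= x' -> S (x', b).
Proof.
move=> /good_swap /good_vertical_tail[d Sd].
by exists d => x b Sxb dx x' dx'; exact: (Sd b x).
Qed.

Lemma good_muln S a b k : good_semigroup S -> S (a, b) -> S (k * a, k * b).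
Proof.
move=> hS Sab; elim: k => [|k IH]; first by case: hS => -[].
by rewrite !mulSn; exact: good_add.
Qed.

(** If [b' = b + k * v], then (oo, b') = (oo, b) + k (u, v), and the second summand is finite, so
    irreducibility selects the first. *)
Lemma Gamma_inf_modn S u v b b' : good_semigroup S -> S (u, v) -> 0 < v ->
  irreducible_elt S (None, Some b) -> irreducible_elt S (None, Some b') ->
  b = b' %[mod v] -> b = b'.
Proof.
move=> hS Suv v0; wlog le : b b' / b <= b'.
  by move=> h Hb Hb' e; case: (leqP b b') => [/h->//|/ltnW/h->].
move=> [Gb _ _] [_ _ irr] /eqP; rewrite eq_sym eqn_mod_dvd// => /dvdnP[k e].
have Gk : Gamma S (Some (k * u), Some (k * v)).
  by apply/GammaE; exact: good_muln.
have [|[->]//|//] := irr _ _ Gb Gk.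
by rewrite /addbar2/=; congr (_, Some _); lia.
Qed.

(** * Nested good semigroups compared edge by edge *)

Section Compare.

Variables S T : set (nat * nat).
Hypotheses (hS : good_semigroup S) (hT : good_semigroup T) (TS : T `<=` S).

(* On the unit square with lower left corner (a, b), agreement of [S] and [T]
   on the bottom and right edges gives agreement on the left and top edges. *)
Lemma square_left a b : (above S a b -> above T a b) ->
  (beyond S a.+1 b -> beyond T a.+1 b) -> beyond S a b -> beyond T a b.
Proof.
move=> bot right [x ax Sxb].
have far : beyond S a.+1 b -> beyond T a.+1 b -> beyond T a b.
  by move=> _ [z az Tz]; exists z => //; exact: ltnW.
have [xa|lt] := leqP x a; last first.
  have Sb : beyond S a.+1 b by exists x.
  exact: far Sb (right Sb).
have {ax xa} ? : x = a by lia.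
subst x; have [y by_ Tay] := bot (ex_intro2 _ _ b (leqnn b) Sxb).
have [yb|lt] := leqP y b.
  by exists a => //; have <- : y = b by lia.
have [z az Szb] := good_exchange1 hS Sxb (TS Tay) lt.
have Sb : beyond S a.+1 b by exists z.
exact: far Sb (right Sb).
Qed.

Lemma square_top a b : (above S a b -> above T a b) ->
  (beyond S a.+1 b -> beyond T a.+1 b) -> above S a b.+1 -> above T a b.+1.
Proof.
move=> bot right [y ltb Say].
have [z bz Taz] := bot (ex_intro2 _ _ y (ltnW ltb) Say).
have [zb|lt] := leqP z b; last by exists z.
have {bz zb} ? : z = b by lia.
(* When T only supplies (a, b), exchange in S gives a point further right in row [b], the right edge
   transfers this to T, and exchange in T lifts (a, b). *)
subst z; have [x ax Sxb] := good_exchange1 hS (TS Taz) Say ltb.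
have [w aw Twb] := right (ex_intro2 _ _ x ax Sxb).
by have [v bv Tav] := good_exchange2 hT Taz Twb aw; exists v.
Qed.

Hypothesis proj1ST : forall a, in_proj1 S a -> in_proj1 T a.

(** From the bottom row and a far column, squares are filled row by row upwards, and leftwards
    within a row. The horizontal edges at height [b] are top edges of squares below, hence [j <= b]
    for [above]. *)
Lemma grid b : (forall j, j < b ->
    Gamma S (None, Some j) -> Gamma T (None, Some j)) ->
  forall j, (j <= b -> forall i, above S i j -> above T i j) /\
    (j < b -> forall i, beyond S i j -> beyond T i j).
Proof.
move=> infST; have [d Sd] := good_horizontal_tail hS.
have row j : j < b -> (forall i, above S i j -> above T i j) ->
    forall i, beyond S i j -> beyond T i j.
  move=> jb bot i.
  (* Here [n] bounds the distance from column [m] to [d]; from [d] on, a single point of S in row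
     [j] puts (oo, j) in [Gamma S]. *)
  suff main n m : d <= m + n -> beyond S m j -> beyond T m j.
    by apply: (main d); exact: leq_addl.
  elim: n m => [|n IH] m le.
    move=> [x mx Sxj]; have dx : d <= x by lia.
    have /infST : Gamma S (None, Some j).
      by apply/GammaE; exists d; exact: Sd Sxj dx.
    move=> /(_ jb)/GammaE[x0 Tx]; exists (maxn m x0); first exact: leq_maxl.
    by apply: Tx; exact: leq_maxr.
  by apply: square_left (bot m) (IH m.+1 _); rewrite addSnnS.
elim=> [|j [IHa IHb]].
  have bot i : above S i 0 -> above T i 0.
    by move=> [y _ Siy]; have [z Tiz] := proj1ST (ex_intro _ y Siy); exists z.
  by split=> // b0; exact: row.
have bot : j < b -> forall i, above S i j.+1 -> above T i j.+1.
  move=> jb i; apply: square_top; first exact: IHa (ltnW jb) i.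
  exact: IHb.
by split=> // jb; apply: row => //; apply: bot; exact: ltnW.
Qed.

Lemma eq_of_proj1_inf :
  (forall b, Gamma S (None, Some b) -> Gamma T (None, Some b)) -> T = S.
Proof.
move=> infST; apply/seteqP; split=> // -[a b] Sab.
(* The bound [b.+1] makes both edges at (a, b) available; the two points of T they provide have
   minimum (a, b). *)
have [ha hb] := @grid b.+1 (fun j _ => infST j) b.
have [y by_ Tay] := ha (leqnSn b) a (ex_intro2 _ _ b (leqnn b) Sab).
have [x ax Txb] := hb (leqnn _) a (ex_intro2 _ _ a (leqnn a) Sab).
by have := good_min hT Tay Txb; rewrite (minn_idPl ax) (minn_idPr by_).
Qed.

End Compare.

(** * Minimality and the count *)

Lemma minimal_of_atoms S (eta : set (nbar * nbar)) :
  good_semigroup S -> contains S eta ->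
  (forall a, atom1 S a -> exists y, eta (Some a, y)) ->
  (forall b, irreducible_elt S (None, Some b) -> eta (None, Some b)) ->
  minimal_good eta S.
Proof.
move=> hS etaS eta1 eta2; split=> // T hT etaT TS.
have p1 a : in_proj1 S a -> in_proj1 T a.
  elim/ltn_ind: a => a IH Sa.
  have [/eta1[y /etaT/Gamma_proj1//]|natom] := pselect (atom1 S a).
  apply: contrapT => nTa; apply: natom; split=> //.
    by case: a nTa {IH Sa} => // -[]; exact: proj1_zero.
  move=> u v Su Sv e; apply: contrapT => /not_orP[u0 v0]; apply: nTa.
  have [|y Ty] := IH u _ Su; first by lia.
  have [|z Tz] := IH v _ Sv; first by lia.
  by exists (y + z); rewrite e; exact: good_add.
apply: eq_of_proj1_inf => // b.
elim/ltn_ind: b => b IH Gb.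
have [/eta2/etaT//|nirr] := pselect (irreducible_elt S (None, Some b)).
have [u [v [e u0 v0 Gu [w Swv]]]] := reducible_inf hS Gb nirr.
have [|x0 Tx] := (GammaE T _).1 (IH u _ Gu); first by lia.
(* From column 0, [beyond] is membership in the second projection, and [v < b]; so T has a point at
   height [v], which shifts the tail at height [u] to one at height [b]. *)
have [_ /(_ _ 0)[||x _ Txv]] := grid hS hT TS p1 IH v; first by lia.
  by exists w.
apply/GammaE; exists (x0 + x) => x' le; rewrite e.
have -> : x' = (x' - x) + x by lia.
by apply: good_add => //; apply: Tx; lia.
Qed.

Lemma card_eq_of_inj_ord (T : Type) (A : set T) (g : T -> nat) m :
  (forall x, A x -> g x < m) ->
  (forall x y, A x -> A y -> g x = g y -> x = y) ->
  exists2 n, n <= m & (A #= `I_n)%card.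
Proof.
move=> gm ginj; have gA : (g @` A #= A)%card.
  by apply: inj_card_eq => x y /set_mem Ax /set_mem Ay; exact: ginj.
have Am : (A #<= `I_m)%card.
  by rewrite -(card_le_eql gA); apply: subset_card_le => _ [x /gm + <-].
have /finite_setP[n An] : finite_set A by apply/finite_set_leP; exists m.
by exists n => //; rewrite -card_le_II -(card_le_eql An).
Qed.

Theorem theorem42 (S : set (nat * nat)) (e : nat * nat)
  (hS : good_semigroup S) (he : is_multiplicity_vector S e) :
  exists n : nat, is_edim S n /\ n <= e.1 + e.2.
Proof.
case: e he => e1 e2 [Se e_neq0 _] /=.
have e1_gt0 : 0 < e1.
  by case: e1 Se e_neq0 => // /good_local1-> // [].
have e2_gt0 : 0 < e2.
  by case: e2 Se e_neq0 => // /good_local2-> // [].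
have /choice[f fP] : forall a, exists y, in_proj1 S a ->
    Gamma S (Some a, y) /\ absolute S (Some a, y).
  move=> a.
  have [/(absolute_above hS)[y hy]|n] := pselect (in_proj1 S a); first by exists y.
  (* A dummy value: [eta] uses [f] only at atoms. *)
  by exists None.
pose eta : set (nbar * nbar) := [set x |
  (exists2 a, atom1 S a & x = (Some a, f a)) \/
  (exists2 b, irreducible_elt S (None, Some b) & x = (None, Some b))].
have etaI : eta `<=` I_A S.
  move=> _ [[a ha ->]|[b hb ->]].
    have [|Ga aa] := fP a; first by case: ha.
    by split=> //; exact: atom1_irreducible.
  split=> //; left; left; right; exists b; split=> //.
  by case: hb => /GammaE.
(* Atoms are sent below [e1] and the (oo, b) to the next [e2] values; (oo, oo) is not in [eta], so
   its value 0 is a dummy. *)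
have [||n le cn] := @card_eq_of_inj_ord _ eta (fun x =>
    match x with
    | (Some a, _) => a %% e1
    | (None, Some b) => e1 + b %% e2
    | _ => 0
    end) (e1 + e2).
- move=> _ [[a _ ->]|[b _ ->]]; last by rewrite ltn_add2l ltn_pmod.
  by apply: ltn_addr; exact: ltn_pmod.
- move=> _ _ [[a ha ->]|[b hb ->]] [[a' ha' ->]|[b' hb' ->]].
  + have Se1 : in_proj1 S e1 by exists e2.
    by move=> /(atom1_modn hS Se1 e1_gt0 ha ha') ->.
  + by have := ltn_pmod a e1_gt0; lia.
  + by have := ltn_pmod a' e1_gt0; lia.
  + move=> /addnI /(Gamma_inf_modn hS Se e2_gt0 hb hb') -> //.
have size_n : edim_sizes S n.
  exists eta; split=> //; apply: minimal_of_atoms => //.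
  - by move=> x /etaI[[]].
  - by move=> a ha; exists (f a); left; exists a.
  - by move=> b hb; right; exists b.
have ex : exists n, `[< edim_sizes S n >] by exists n; apply/asboolP.
case: (ex_minnP ex) => m /asboolP size_m min_m; exists m; split.
  by split=> // k /asboolP/min_m.
by apply: leq_trans le; apply: min_m; apply/asboolP.
Qed.
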